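(* Let $n,k$ be positive integers with $k<\frac n2$, and let $2\leq l\leq k$ and $0\leq j\leq l$ be integers. Provided that $k$ divides $n$, we have $$b_{l,j}=\begin{cases}\dfrac{(n-2k)!}{(k!)^{n/k-2}(\frac{n}{k}-2)!}\dbinom{n-k-l}{k-l}&\text{if } j=0,\\[2mm] 0&\text{if } 0<j<l,\\[1mm] \dfrac{(n-k)!}{(k!)^{n/k-1}(\frac{n}{k}-1)!}&\text{if } j=l.\end{cases}$$ In particular, we have $$\lambda_l=\frac{(n-k)!}{(k!)^{n/k-1}(\frac{n}{k}-1)!}+(-1)^l\frac{(n-2k)!}{(k!)^{n/k-2}(\frac{n}{k}-2)!}\binom{n-k-l}{k-l}.$$
   Context: $\mathbb{Z}_n$ is the set of integers modulo $n$ and $\mathbb{Z}_n^{(k)}$ is the set of its $k$-element subsets. For a bijection $\pi:\mathbb{Z}_n\to\mathbb{Z}_n$, let $\mathcal{F}_\pi=\{\{\pi((i-1)k+1),\ldots,\pi(ik)\} : i\in\mathbb{Z}_n\}\subset\mathbb{Z}_n^{(k)}$. An $(n,k)$-wreath is a family of the form $\mathcal{F}_\pi$; $\mathcal{W}_{n,k}$ is the set of all of them. The $(n,k)$-wreath matrix $M$ has rows and columns labelled by $\mathcal{W}_{n,k}$ and entries $M_{\mathcal{F},\mathcal{F}'}=|\mathcal{F}\cap\mathcal{F}'|$. Let $S_n$ be the group of permutations of $\mathbb{Z}_n$. Let $V$ be the complex vector space with basis $\{e_{\mathcal{F}}:\mathcal{F}\in\mathcal{W}_{n,k}\}$ (with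 the inner product making this basis orthonormal), with $S_n$ acting by $\tau e_{\mathcal{F}_\pi}=e_{\mathcal{F}_{\tau\pi}}$; $M$ acts on $V$. For $T\in\mathbb{Z}_n^{(k)}$ let $w_T=\sum_{\mathcal{F}\ni T}e_{\mathcal{F}}$, and for $A\subseteq\mathbb{Z}_n$ with $|A|\le k$ let $w_A=\sum_{A\subseteq B,\,|B|=k}w_B$. Definition of $\lambda_l$ ($2\le l\le k$): let $V_k$ be the permutation $\mathbb{C}S_n$-module with basis $\{v_T:T\in\mathbb{Z}_n^{(k)}\}$, which decomposes as $V_k=\bigoplus_{i=0}^k U_i$ with $U_i$ isomorphic to the Specht module $S^{(n-i,i)}$; let $\Phi:V_k\to V$ be the $\mathbb{C}S_n$-homomorphism with $\Phi(v_T)=w_T$, and let $E_l=\Phi(U_l)$, which for $2\le l\le k$ is isomorphic to $U_l$. The matrix $M$ acts on $E_l$ by multiplication by a scalar, and $\lambda_l$ is this scalar. Definition of $b_{l,j}$ ($2\le l\le k$, $0\le j\le l$): $b_{l,j}=\langle w_{\{1,\dots,l\}},\,w_{\{l-j+1,l-j+2,\ldots,l-j+k\}}\rangle$. By symmetry, $b_{l,j}=\langle w_T,w_A\rangle$ whenever $|A|=l$, $|T|=k$, $|A\cap T|=j$. *)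

(* Defs.v *)
From HB Require Import structures.
From mathcomp Require Import all_boot all_order all_algebra all_fingroup.
From mathcomp Require Import mxrepresentation spectral.
From mathcomp Require Import reals complex.

Set Implicit Arguments.
Unset Strict Implicit.
Unset Printing Implicit Defensive.

Import GroupScope GRing.Theory.
Local Open Scope ring_scope.

(* Permutations compose from left to right in MathComp, (s * t) x = t (s x),  *)
(* so the left modules of the usual convention appear as right modules, a     *)
(* group element g acting on a row vector v by v *m rG g.                     *)

Section PermutationModule.

Variables (F : fieldType) (gT : finGroupType) (G : {group gT}).
Variables (rT : finType) (to : {action gT &-> rT}) (S : {set rT}).

(* The free vector space on S is 'rV_#|S|, the i-th coordinate being that on  *)
(* enum_val i; basis_vec x is the basis vector indexed by x (if x \in S).     *)
Definition basis_vec (x : rT) : 'rV[F]_#|S| := \row_j (enum_val j == x)%:R.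

Definition permod_mx (g : gT) : 'M[F]_#|S| :=
  \matrix_(i < #|S|) basis_vec (to (enum_val i) g).

Lemma basis_vecE (x : rT) (xS : x \in S) :
  basis_vec x = delta_mx 0 (enum_rank_in xS x).
Proof.
apply/rowP => j; rewrite !mxE eqxx /=; congr (nat_of_bool _)%:R.
apply/eqP/eqP => [e|->]; last by rewrite enum_rankK_in.
by apply: enum_val_inj; rewrite enum_rankK_in.
Qed.

Lemma basis_vec_permod (acts : [acts G, on S | to]) x g :
  x \in S -> g \in G -> basis_vec x *m permod_mx g = basis_vec (to x g).
Proof.
move=> xS gG; rewrite basis_vecE -rowE rowK; congr basis_vec.
by rewrite enum_rankK_in.
Qed.

Lemma permod_mx_repr (acts : [acts G, on S | to]) : mx_repr G permod_mx.
Proof.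
split=> [|g h gG hG]; apply/row_matrixP => i.
  rewrite rowK act1 row1 (basis_vecE (enum_valP i)); congr delta_mx.
  by rewrite enum_valK_in.
rewrite row_mul !rowK basis_vec_permod ?actM //.
by rewrite (acts_act acts) ?enum_valP.
Qed.

Definition permod_repr (acts : [acts G, on S | to]) :=
  MxRepresentation (permod_mx_repr acts).

End PermutationModule.

Section Specht.

Variables (F : fieldType) (X : finType) (lam : seq nat).

Local Notation pos := ('I_#|X|)%type.

Section FfunAction.
Variable T : finType.

Definition ffun_act (f : {ffun X -> T}) (s : {perm X}) : {ffun X -> T} :=
  [ffun x => f (s^-1%g x)].

Lemma ffun_act1 f : ffun_act f 1 = f.
Proof. by apply/ffunP => x; rewrite ffunE invg1 perm1. Qed.

Lemma ffun_actM f s t : ffun_act f (s * t) = ffun_act (ffun_act f s) t.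
Proof. by apply/ffunP => x; rewrite !ffunE invMg permM. Qed.

Canonical ffun_action := TotalAction ffun_act1 ffun_actM.
End FfunAction.

(* A tableau of shape lam (a partition of #|X|) is encoded by the bijection   *)
(* sending each x in X to the pair (row, column), counted from 0, of the cell *)
(* of the Young diagram of lam that contains x.                               *)
Definition tableaux : {set {ffun X -> pos * pos}} :=
  [set t : {ffun X -> pos * pos} |
    injectiveb t && [forall x, ((t x).2 < nth 0%N lam (t x).1)%N]].

(* The row equivalence class of t is given by the function sending each x to  *)
(* its row.                                                                   *)
Definition tabloid (t : {ffun X -> pos * pos}) : {ffun X -> pos} :=
  [ffun x => (t x).1].

Definition tabloids : {set {ffun X -> pos}} := [set tabloid t | t in tableaux].

Lemma tableaux_act t (s : {perm X}) :
  (ffun_act t s \in tableaux) = (t \in tableaux).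
Proof.
rewrite !inE; congr andb.
  apply/injectiveP/injectiveP => inj x y.
    by move=> e; apply: (@perm_inj _ s); apply: inj; rewrite !ffunE !permK.
  by rewrite !ffunE => /inj/perm_inj.
apply/forallP/forallP => h x; last by rewrite ffunE.
by have := h (s x); rewrite ffunE permK.
Qed.

Lemma tabloid_act t s : tabloid (ffun_act t s) = ffun_act (tabloid t) s.
Proof. by apply/ffunP => x; rewrite !ffunE. Qed.

Lemma tabloids_acts :
  [acts [set: {perm X}], on tabloids | ffun_action pos].
Proof.
apply/actsP => s _ r; apply/imsetP/imsetP => [[t tP e]|[t tP ->]].
  exists (ffun_act t s^-1); first by rewrite tableaux_act.
  by rewrite tabloid_act -e /= -ffun_actM mulgV ffun_act1.
exists (ffun_act t s); first by rewrite tableaux_act.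
by rewrite tabloid_act.
Qed.

Definition tabloid_repr := permod_repr F tabloids_acts.

Definition column_stab (t : {ffun X -> pos * pos}) : {set {perm X}} :=
  [set s : {perm X} | [forall x, (t (s x)).2 == (t x).2]].

Definition polytabloid (t : {ffun X -> pos * pos}) : 'rV[F]_#|tabloids| :=
  \sum_(s in column_stab t)
     (-1) ^+ s *: basis_vec F tabloids (tabloid (ffun_act t s)).

Definition specht_mx : 'M[F]_#|tabloids| :=
  (\sum_(t in tableaux) <<polytabloid t>>)%MS.

Lemma polytabloid_act t s : t \in tableaux ->
  polytabloid t *m tabloid_repr s = polytabloid (ffun_act t s).
Proof.
move=> tP; rewrite mulmx_suml [RHS](reindex_inj (conjg_inj s)) /=.
apply: eq_big => [u|u _].
  rewrite !inE; apply/forallP/forallP => h x.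
    by have := h (s^-1%g x); rewrite !ffunE !permM permK.
  by have := h (s x); rewrite !ffunE !permM !permK.
rewrite -scalemxAl odd_permJ (basis_vec_permod F tabloids_acts) ?inE //=.
  rewrite -tabloid_act -!ffun_actM; congr (_ *: basis_vec _ _ (tabloid _)).
  by rewrite conjgE !mulgA mulgV mul1g.
by apply: imset_f; rewrite tableaux_act.
Qed.

Lemma specht_mxmodule : mxmodule tabloid_repr specht_mx.
Proof.
apply/mxmoduleP => s _; rewrite sumsmxMr; apply/sumsmx_subP => t tP.
rewrite (eqmxMr _ (genmxE _)) polytabloid_act //.
apply: submx_trans (sumsmx_sup (ffun_act t s) _ (submx_refl _)).
  by rewrite genmxE.
by rewrite tableaux_act.
Qed.

Definition specht_repr := submod_repr specht_mxmodule.

End Specht.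

Section Wreath.

Variables n k : nat.

Local Notation Zn := ('Z_n)%type.

Definition ksubsets : {set {set Zn}} :=
  [set T : {set Zn} | #|T| == k].

Definition wreath_block (s : {perm Zn}) (i : Zn) : {set Zn} :=
  [set s ((i - 1) * k%:R + r.+1%:R) | r : 'I_k].

Definition wreath (s : {perm Zn}) : {set {set Zn}} :=
  [set wreath_block s i | i : Zn].

Definition wreaths : {set {set {set Zn}}} :=
  [set wreath s | s : {perm Zn}].

Lemma wreath_act s t : (('P^*)^*)%act (wreath s) t = wreath (s * t)%g.
Proof.
rewrite /= /setact /wreath -imset_comp; apply: eq_imset => i /=.
rewrite /setact /wreath_block -imset_comp; apply: eq_imset => r /=.
by rewrite /aperm permM.
Qed.

Lemma wreaths_acts : [acts [set: {perm Zn}], on wreaths | ('P^*)^*].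
Proof.
apply/actsP => t _ W; apply/imsetP/imsetP => [[s _ e]|[s _ ->]].
  by exists (s * t^-1)%g; rewrite // -wreath_act -e actKin ?inE.
by exists (s * t)%g; rewrite // wreath_act.
Qed.

Lemma ksubsets_acts : [acts [set: {perm Zn}], on ksubsets | 'P^*].
Proof.
apply/actsP => t _ T; rewrite !inE /= /setact card_imset //.
exact: perm_inj.
Qed.

Variable C : numClosedFieldType.

Definition V_repr := permod_repr C wreaths_acts.
Definition Vk_repr := permod_repr C ksubsets_acts.

Definition wreath_mx : 'M[C]_#|wreaths| :=
  \matrix_(i, j) #|enum_val i :&: enum_val j|%:R.

Definition w_block (T : {set Zn}) : 'rV[C]_#|wreaths| :=
  \sum_(W in wreaths | T \in W) basis_vec C wreaths W.

Definition w_set (A : {set Zn}) : 'rV[C]_#|wreaths| :=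
  \sum_(B in ksubsets | A \subset B) w_block B.

Lemma w_set_ksubset T : T \in ksubsets -> w_set T = w_block T.
Proof.
move=> Tk; rewrite /w_set (big_pred1 T) // => B.
apply/andP/eqP => [[Bk sTB]|->//]; move: Tk Bk; rewrite !inE => /eqP <- /eqP e.
by apply/esym/eqP; rewrite eqEcard sTB e /=.
Qed.

(* interval m p = {m+1, ..., m+p} *)
Definition interval (m p : nat) : {set Zn} := [set (m + r.+1)%:R | r : 'I_p].

Definition b_coef (l j : nat) : C :=
  dotmx (w_set (interval 0 l)) (w_block (interval (l - j) k)).

(* The matrix of the linear map sending the basis vector of T to w_T. *)
Definition Phi : 'M[C]_(#|ksubsets|, #|wreaths|) :=
  \matrix_(i < #|ksubsets|) w_block (enum_val i).

Lemma w_block_act T t : w_block T *m V_repr t = w_block (('P^*)%act T t).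
Proof.
have inj : injective (('P^*)^*%act^~ t : {set {set Zn}} -> {set {set Zn}}).
  exact: act_inj.
rewrite mulmx_suml [RHS](reindex_inj inj) /=.
apply: eq_big => [W|W /andP[WW _]]; last first.
  by rewrite (basis_vec_permod C wreaths_acts) ?inE.
rewrite (acts_act wreaths_acts) ?inE //; congr andb.
by rewrite /= /setact mem_imset //; apply: act_inj.
Qed.

Lemma Phi_hom t : Vk_repr t *m Phi = Phi *m V_repr t.
Proof.
apply/row_matrixP => i; rewrite !row_mul !rowK w_block_act.
have TS : ('P^*)%act (enum_val i) t \in ksubsets.
  by rewrite (acts_act ksubsets_acts) ?in_setT ?enum_valP.
by rewrite (basis_vecE _ TS) -rowE rowK enum_rankK_in.
Qed.

(* V_k is the direct sum of submodules U 0, ..., U k, with U i isomorphic to  *)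
(* the Specht module of the partition (n - i, i).                             *)
Definition Vk_decomposition (U : nat -> 'M[C]_#|ksubsets|) : Prop :=
  [/\ forall i, (i <= k)%N ->
        exists modU : mxmodule Vk_repr (U i),
          mx_rsim (submod_repr modU) (specht_repr C Zn [:: n - i; i]%N),
      mxdirect (\sum_(i < k.+1) U i)%MS
    & (\sum_(i < k.+1) U i == 1%:M)%MS].

Definition E_mx (U : nat -> 'M[C]_#|ksubsets|) (l : nat) :
  'M[C]_(#|ksubsets|, #|wreaths|) := U l *m Phi.

(* E_l is the row space of E_mx U l, and wreath_mx acts on it by right        *)
(* multiplication, which is the usual action since wreath_mx is symmetric.    *)
(* The equivalence says that wreath_mx acts on E_l as the scalar c and, E_l   *)
(* being nonzero, as no other scalar.                                         *)
Definition is_lambda (U : nat -> 'M[C]_#|ksubsets|) (l : nat) (c : C) : Prop :=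
  forall a : C, (E_mx U l <= eigenspace wreath_mx a)%MS <-> a = c.

End Wreath.

(* Main.v *)
Require Import Defs.
From mathcomp Require Import all_boot all_order all_algebra all_fingroup.
From mathcomp Require Import mxrepresentation spectral.
From mathcomp Require Import reals complex.
From mathcomp Require Import zify ring.

(** Put m = n / k, and let N q be the number of partitions of a set of q * k
    elements into blocks of size k, so that N q = (q * k)! / (k!^q * q!)
    ([npart_fact]).  Since k divides n, the wreaths are exactly the partitions
    of Z_n into blocks of size k ([wreathsE]).  The number of wreaths that
    contain two given k-sets T and T' is therefore N (m - 1) if T = T',
    N (m - 2) if T and T' are disjoint, and 0 otherwise ([gramE]).

    The inner product of w_A and w_T is the sum of these numbers over the k-sets
    B that contain A.  If A is contained in T, only B = T contributes.  If A
    meets T without being contained in it, every such B is distinct from T and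
    meets it.  If A and T are disjoint, there remain the
    C(n - k - l, k - l) sets B between A and the complement of T.

    For the eigenvalue, the wreath matrix is Phi^T Phi, so that on the image of
    Phi it is governed by
      Phi Phi^T = N (m - 1) I + N (m - 2) K,
    where K is the disjointness matrix of the k-sets (the adjacency matrix of
    the Kneser graph).  It suffices to know how K acts on U_l, and for this it is
    enough to look at the images u in U_l of the polytabloids that span the
    Specht module.  The polytabloid of a tableau of shape (n - l, l) changes
    sign under the transposition (a_c b_c) of each of the l columns of height 2,
    and is fixed by the transpositions of elements outside these columns; u
    inherits both properties because U_l is isomorphic to the Specht module.
    Seen as a function on k-sets, u then vanishes on the sets that do not contain
    exactly one element of each pair {a_c, b_c}.  For a set T that does, a set T'
    disjoint from T on which u does not vanish contains the other element of each
    pair, so that u T' = (-1)^l u T, and there are C(n - k - l, k - l) such sets T'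
    ([kneser_sum]): the same count as in the first part, which is why the same
    binomial coefficient appears.  Hence K acts on U_l as
    (-1)^l C(n - k - l, k - l).

    The scalar obtained is nonzero, because
    N (m - 1) = N (m - 2) C(n - k - 1, k - 1) and l >= 2 ([npart_lt]).  As U_l is
    nonzero, so is its image under Phi, and the scalar by which the wreath matrix
    acts on this image is unique. *)

Set Implicit Arguments.
Unset Strict Implicit.
Unset Printing Implicit Defensive.

Import GroupScope GRing.Theory Num.Theory.

(** * Partitions into blocks of equal size *)

Section UniformPartitions.
Variables (X : finType) (k : nat).
Implicit Types (A B D T : {set X}) (P Q : {set {set X}}).

(** Removing A identifies these sets with the subsets of size q of D :\: A. *)
Lemma card_between A D q : A \subset D ->
  #|[set B : {set X} | [&& A \subset B, B \subset D & #|B| == q + #|A|]]|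
  = 'C(#|D| - #|A|, q).
Proof.
move=> sAD; rewrite -(cardsDS sAD) -cards_draws.
have inj : {in [set B : {set X} | (B \subset D :\: A) & (#|B| == q)] &,
    injective (fun B => A :|: B)}.
  move=> B B'; rewrite !inE !subsetD => /andP[/andP[_ dB] _] /andP[/andP[_ dB'] _] e.
  rewrite disjoint_sym in dB; rewrite disjoint_sym in dB'.
  have := congr1 (fun Y => Y :\: A) e.
  by rewrite !setDUl setDv !set0U !(setDidPl _) // disjoint_sym.
rewrite -(card_in_imset inj); apply: eq_card => B; rewrite inE.
apply/and3P/imsetP => [[sAB sBD /eqP cB]|[B']].
  exists (B :\: A); last by rewrite setDE setUIr setUCr setIT; apply/esym/setUidPr.
  by rewrite !inE setSD //= cardsDS // cB addnK.
rewrite !inE subsetD => /andP[/andP[sB'D dB'] /eqP cB'] ->; split.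
- exact: subsetUl.
- by rewrite subUset sAD.
- by rewrite cardsU (_ : A :&: B' = set0) ?cards0 ?subn0 ?cB' 1?addnC //
     setIC; apply/eqP; rewrite setI_eq0.
Qed.

Definition kpart D : {set {set {set X}}} :=
  [set P | partition P D && [forall B in P, #|B| == k]].

Lemma kpartP D P :
  reflect (partition P D /\ {in P, forall B, #|B| = k}) (P \in kpart D).
Proof.
rewrite inE; apply: (iffP andP) => -[pP cP]; split=> //.
  by move=> B BP; apply/eqP; move/forall_inP: cP; apply.
by apply/forall_inP => B /cP ->.
Qed.

Lemma kpart_block_sub D P B : P \in kpart D -> B \in P -> B \subset D.
Proof.
by move=> /kpartP[/and3P[/eqP <- _ _] _] BP; rewrite /cover (bigcup_max B).
Qed.

Lemma kpart_disjoint D P A B : P \in kpart D -> A \in P -> B \in P ->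
  A != B -> [disjoint A & B].
Proof. by move=> /kpartP[/and3P[_ /trivIsetP tP _] _]; apply: tP. Qed.

Lemma card_kpart_elt D P : P \in kpart D -> #|D| = (#|P| * k)%N.
Proof. by case/kpartP=> pP cP; apply: card_uniform_partition pP. Qed.

Hypothesis k_gt0 : (0 < k)%N.

(** Partitions with a prescribed block B are the partitions of the rest, to
    which B is added back: the recursion behind every count of partitions. *)
Lemma kpart_rem D B : B \subset D -> #|B| = k ->
  [set P in kpart D | B \in P] = [set B |: Q | Q in kpart (D :\: B)].
Proof.
move=> sBD cB; have B0 : B != set0 by rewrite -card_gt0 cB.
apply/setP => P; rewrite inE; apply/andP/imsetP => [[PD BP]|[Q QD ->]].
  exists (P :\ B); last by rewrite setD1K.
  have [/and3P[/eqP covP tP P0] cP] := kpartP _ _ PD.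
  apply/kpartP; split; last by move=> A /setD1P[_ /cP].
  apply/and3P; split; last by rewrite !inE (negPf P0) andbF.
    apply/eqP/setP => x; rewrite -covP; apply/bigcupP/setDP.
      case=> A /setD1P[AB AP] xA; split; first by apply/bigcupP; exists A.
      by have /disjoint_setI0/setP/(_ x) := kpart_disjoint PD AP BP AB;
         rewrite !inE xA /= => ->.
    case=> /bigcupP[A AP xA] xB; exists A => //.
    by rewrite !inE AP andbT; apply: contraNneq xB => <-.
  by apply: trivIsetS tP; apply: subD1set.
have [/and3P[/eqP covQ tQ Q0] cQ] := kpartP _ _ QD.
split; last exact: setU11.
apply/kpartP; split; last by move=> A /setU1P[->|/cQ].
apply/and3P; split.
- rewrite /cover bigcup_setU big_set1 -/(cover Q) covQ.
  by apply/eqP; rewrite setDE setUIr setUCr setIT; apply/setUidPr.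
- have dBQ : {in Q, forall A, [disjoint B & A]}.
    move=> A AQ; rewrite disjoint_sym.
    by have := kpart_block_sub QD AQ; rewrite subsetD => /andP[].
  by have [] := trivIsetU1 dBQ tQ Q0.
- by rewrite !inE negb_or eq_sym B0.
Qed.

Lemma kpart_rem_inj D B : #|B| = k ->
  {in kpart (D :\: B) &, injective (fun Q => B |: Q)}.
Proof.
move=> cB; have notB Q : Q \in kpart (D :\: B) -> B \notin Q.
  move=> QD; apply/negP => /(kpart_block_sub QD).
  rewrite subsetD -setI_eq0 setIid => /andP[_ /eqP B0].
  by move: k_gt0; rewrite -cB B0 cards0.
by move=> Q Q' /notB nQ /notB nQ' e; rewrite -(setU1K nQ) e setU1K.
Qed.

Lemma card_kpart_mem D B : B \subset D -> #|B| = k ->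
  #|[set P in kpart D | B \in P]| = #|kpart (D :\: B)|.
Proof.
by move=> sBD cB; rewrite kpart_rem // card_in_imset //; apply: kpart_rem_inj.
Qed.

Lemma card_kpart_mem2 D A B : A \subset D -> B \subset D ->
  #|A| = k -> #|B| = k -> [disjoint A & B] ->
  #|[set P in kpart D | (A \in P) && (B \in P)]| = #|kpart (D :\: A :\: B)|.
Proof.
move=> sAD sBD cA cB dAB.
have AB : A != B.
  by apply: contraTneq dAB => ->; rewrite -setI_eq0 setIid -card_gt0 cB.
rewrite -card_kpart_mem // ?subsetD ?sBD 1?disjoint_sym //.
rewrite -[RHS](card_in_imset (f := fun Q => A |: Q)); last first.
  by move=> Q Q' /setIdP[QD _] /setIdP[Q'D _]; apply: (kpart_rem_inj cA) QD Q'D.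
apply: eq_card => P; rewrite inE andbA.
have := kpart_rem sAD cA => /setP/(_ P); rewrite inE => ->.
apply/andP/imsetP => [[/imsetP[Q QD ->] /setU1P[/eqP|BQ]]|[Q]].
- by rewrite eq_sym (negPf AB).
- by exists Q; rewrite // inE QD.
- by rewrite inE => /andP[QD BQ] ->; rewrite imset_f // inE BQ orbT.
Qed.

(** The i-th factor counts the choices of the block that contains a given
    element, among the (i + 1) * k elements that are still to be covered. *)
Definition npart q := (\prod_(i < q) 'C((i.+1 * k).-1, k.-1))%N.

(** Fix x in D and sort the partitions of D by the block that contains x. *)
Lemma card_kpart D q : #|D| = (q * k)%N -> #|kpart D| = npart q.
Proof.
elim: q D => [|q IHq] D cD.
  have -> : D = set0 by apply: cards0_eq.
  rewrite /npart big_ord0; apply/eqP/cards1P; exists set0.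
  apply/setP => P; rewrite in_set1; apply/kpartP/eqP => [[pP _]|->].
    by apply/eqP; rewrite -partition_set0.
  by split; [rewrite partition_set0 | move=> B; rewrite inE].
have [x xD] : exists x, x \in D by apply/card_gt0P; rewrite cD muln_gt0.
rewrite /npart big_ord_recr /= -/(npart q).
(* Exactly one block of P contains x. *)
have pE P : P \in kpart D ->
    (1 = \sum_(B : {set X} | [&& [set x] \subset B, B \subset D & #|B| == k])
        (B \in P))%N.
  move=> PD; have [pP cP] := kpartP _ _ PD.
  have /and3P[/eqP covP tP _] := pP.
  have xP : x \in cover P by rewrite covP.
  have bP := pblock_mem xP.
  rewrite (bigD1 (pblock P x)) /=; last first.
    by rewrite sub1set mem_pblock xP (kpart_block_sub PD bP) cP /=.
  rewrite bP big1 // => B /andP[/and3P[xB _ _] Bx]; rewrite sub1set in xB.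
  case BP: (B \in P) => //.
  by rewrite (def_pblock tP BP xB) eqxx in Bx.
rewrite -sum1_card (eq_bigr _ pE) exchange_big /=.
transitivity (\sum_(B : {set X} | [&& [set x] \subset B, B \subset D & #|B| == k])
   npart q)%N.
  apply: eq_bigr => B /and3P[_ sBD /eqP cB].
  rewrite -(IHq (D :\: B)); last by rewrite cardsDS // cD cB mulSn addKn.
  rewrite -card_kpart_mem // -sum1dep_card big_mkcondr /=.
  by apply: eq_bigr => P _; case: (B \in P).
rewrite sum_nat_const mulnC; congr (_ * _)%N.
rewrite -[RHS](_ : 'C(#|D| - #|[set x]|, k.-1) = _); last first.
  by rewrite cD cards1 subn1.
rewrite -card_between ?sub1set // cards1 addn1 prednK //.
by apply: eq_card => B; rewrite !inE.
Qed.

(** The product telescopes: (q + 1) k! (q k)! C((q + 1) k - 1, k - 1) is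
    ((q + 1) k)!.  Stated without division, it holds in nat. *)
Lemma npart_fact q : (npart q * (k`! ^ q * q`!) = (q * k)`!)%N.
Proof.
elim: q => [|q IHq]; first by rewrite /npart big_ord0.
rewrite /npart big_ord_recr /= -/(npart q) expnS factS.
have := bin_fact (n := (q.+1 * k).-1) (m := k.-1).
have -> : ((q.+1 * k).-1 - k.-1 = q * k)%N by nia.
have -> : (k`! = k * (k.-1)`!)%N by rewrite -{1 2}(prednK k_gt0) factS.
have -> : ((q.+1 * k)`! = (q.+1 * k) * ((q.+1 * k).-1)`!)%N.
  by rewrite -{1}(@prednK (q.+1 * k)) ?muln_gt0 // factS prednK // muln_gt0.
move=> <-; last by nia.
rewrite -IHq (_ : k`! = k * (k.-1)`!)%N; last by rewrite -{1 2}(prednK k_gt0) factS.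
ring.
Qed.

End UniformPartitions.

(** * Wreaths are the partitions into blocks of size k *)

Local Open Scope ring_scope.

Section WreathsArePartitions.
Variables (n k : nat).
Hypotheses (n_gt1 : (1 < n)%N) (k_gt0 : (0 < k)%N) (dvdkn : (k %| n)%N).
Local Notation m := (n %/ k)%N.

Lemma card_Zn : #|'Z_n| = n.
Proof. by rewrite card_ord Zp_cast. Qed.

Lemma mk_n : (m * k)%N = n.
Proof. exact: divnK. Qed.

Lemma m_gt0 : (0 < m)%N.
Proof. by rewrite divn_gt0 // dvdn_leq // ltnW. Qed.

Lemma ltn_Zn (x : 'Z_n) : (x < n)%N.
Proof. by rewrite -[X in (_ < X)%N](Zp_cast n_gt1) ltn_ord. Qed.

(** Multiplication by k sends Z_n to the multiples of k modulo m * k, hence only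
    y modulo m matters; no further wrap-around takes place since r < k. *)
Lemma val_block_elt (y : 'Z_n) r : (r < k)%N ->
  (y * k%:R + r.+1%:R - 1 : 'Z_n) = (y %% m * k + r)%N :> nat.
Proof.
move=> ltrk; have -> : y * k%:R + r.+1%:R - 1 = (y * k + r)%N%:R :> 'Z_n.
  by rewrite -[r.+1]addn1 !natrD natrM natr_Zp addrA addrK.
rewrite val_Zp_nat //.
have ltm := ltn_pmod y m_gt0.
rewrite {1}(divn_eq y m) mulnDl -mulnA mk_n -addnA modnMDl modn_small //.
by rewrite -[X in (_ < X)%N]mk_n; nia.
Qed.

(** Blocks are made of the elements (i - 1) * k + r + 1 with r < k, so that
    shifting indices by 1 turns them into the fibres of the division by k. *)
Definition offset (x : 'Z_n) : nat := (x - 1)%R.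

Lemma offset_inj : injective offset.
Proof. by move=> x y e; apply: (addIr (-1)); apply: val_inj. Qed.

(** Describing a block by an equation on its elements makes it evident that the
    distinct blocks of a wreath are disjoint. *)
Lemma mem_wreath_block (s : {perm 'Z_n}) i x :
  (x \in wreath_block k s i) = (offset (s^-1%g x) %/ k == offset i %% m)%N.
Proof.
apply/imsetP/eqP => [[r _ ->]|e].
  by rewrite permK /offset val_block_elt // divnMDl // (divn_small (ltn_ord r)) addn0.
have ltr := ltn_pmod (offset (s^-1%g x)) k_gt0.
exists (Ordinal ltr) => //=; rewrite -[LHS](permKV s); congr (s _).
apply: offset_inj; rewrite /offset.
by rewrite [RHS]val_block_elt // -e -divn_eq.
Qed.

Lemma card_wreath_block (s : {perm 'Z_n}) i : #|wreath_block k s i| = k.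
Proof.
rewrite card_imset ?card_ord // => r r' /perm_inj e.
have := congr1 offset e.
by rewrite /offset !val_block_elt // => /addnI/val_inj.
Qed.

Lemma wreath_kpart (s : {perm 'Z_n}) : wreath k s \in kpart k [set: 'Z_n].
Proof.
apply/kpartP; split; last by move=> _ /imsetP[i _ ->]; apply: card_wreath_block.
apply/and3P; split.
- rewrite eqEsubset subsetT /=; apply/subsetP => x _; apply/bigcupP.
  pose q := (offset (s^-1%g x) %/ k)%N.
  have ltqm : (q < m)%N by rewrite /q ltn_divLR // mk_n ltn_Zn.
  have ltqn : (q < n)%N by apply: leq_trans ltqm (leq_div _ _).
  exists (wreath_block k s (q%:R + 1)); first exact: imset_f.
  rewrite mem_wreath_block /offset addrK val_Zp_nat // (modn_small ltqn).
  by rewrite (modn_small ltqm).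
- apply/trivIsetP => _ _ /imsetP[i _ ->] /imsetP[j _ ->] ne.
  apply/pred0P => x /=; rewrite !mem_wreath_block.
  apply/negP => /andP[/eqP -> /eqP e]; case/eqP: ne.
  by apply/setP => y; rewrite !mem_wreath_block e.
- apply/imsetP => -[i _ e]; have := card_wreath_block s i.
  by rewrite -e cards0 => k0; move: k_gt0; rewrite -{1}k0 ltnn.
Qed.

(** List the blocks of P, and the elements of each block: reading these lists one
    after the other gives a permutation whose wreath is P. *)
Lemma kpart_wreath (P : {set {set 'Z_n}}) :
  P \in kpart k [set: 'Z_n] -> P \in wreaths n k.
Proof.
move=> Pk; have [pP cP] := kpartP _ _ _ Pk.
have cardP : #|P| = m.
  have := card_kpart_elt Pk.
  rewrite cardsT card_Zn => e.
  by apply/eqP; rewrite -(eqn_pmul2r k_gt0) -e mk_n.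
pose blk (q : nat) := nth set0 (enum P) q.
have blkP q : (q < m)%N -> blk q \in P.
  by move=> ltq; rewrite -mem_enum mem_nth // -cardE cardP.
pose f (x : 'Z_n) := nth 0 (enum (blk (offset x %/ k)%N)) (offset x %% k)%N.
have ltq (x : 'Z_n) : (offset x %/ k < m)%N by rewrite ltn_divLR // mk_n ltn_Zn.
have fP x : f x \in blk (offset x %/ k)%N.
  by rewrite -mem_enum mem_nth // -cardE cP ?blkP // ltn_pmod.
have finj : injective f.
  move=> x y e.
  have eq : (offset x %/ k = offset y %/ k)%N.
    apply/eqP; rewrite -(nth_uniq set0 (s := enum P)) ?enum_uniq -?cardE ?cardP //.
    apply/negPn/negP => ne.
    have := kpart_disjoint Pk (blkP _ (ltq x)) (blkP _ (ltq y)) ne.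
    by move/disjoint_setI0/setP/(_ (f x)); rewrite inE fP e fP inE.
  apply: offset_inj; rewrite (divn_eq (offset x) k) (divn_eq (offset y) k) eq; congr (_ + _)%N.
  apply/eqP; rewrite -(nth_uniq 0 (s := enum (blk (offset x %/ k)%N))) ?enum_uniq //.
  - by apply/eqP; rewrite {2}eq.
  - by rewrite -cardE cP ?blkP ?ltn_pmod.
  - by rewrite -cardE cP ?blkP ?ltn_pmod.
(* Both sides have m members, so one inclusion suffices. *)
apply/imsetP; exists (perm finj) => //; apply/esym/eqP.
have cW := card_kpart_elt (wreath_kpart (perm finj)).
have cP' := card_kpart_elt Pk.
rewrite eqEcard; apply/andP; split; last first.
  by rewrite -(leq_pmul2r k_gt0) -cW -cP'.
apply/subsetP => _ /imsetP[i _ ->].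
have lti := ltn_pmod (offset i) m_gt0.
rewrite (_ : wreath_block _ _ _ = blk (offset i %% m)%N) ?blkP //.
apply/eqP; rewrite eqEcard card_wreath_block cP ?blkP // leqnn andbT.
apply/subsetP => x; rewrite mem_wreath_block => /eqP <-.
by rewrite -[x in x \in _](permKV (perm finj)) permE fP.
Qed.

Lemma wreathsE : wreaths n k = kpart k [set: 'Z_n].
Proof.
apply/setP => P; apply/idP/idP; last exact: kpart_wreath.
by case/imsetP=> s _ ->; apply: wreath_kpart.
Qed.

End WreathsArePartitions.

Section Gram.
Variables (n k : nat).
Hypotheses (n_gt1 : (1 < n)%N) (k_gt0 : (0 < k)%N) (dvdkn : (k %| n)%N).
Hypothesis (lt2kn : (2 * k < n)%N).
Local Notation m := (n %/ k)%N.

(** The inner product of w_T and w_T'. *)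
Definition gram (T T' : {set 'Z_n}) : nat :=
  #|[set W in wreaths n k | (T \in W) && (T' \in W)]|.

Lemma gramE T T' : T \in ksubsets n k -> T' \in ksubsets n k ->
  gram T T' = (if T == T' then npart k (m - 1)
    else if [disjoint T & T'] then npart k (m - 2) else 0)%N.
Proof.
rewrite /gram wreathsE // !inE => /eqP cT /eqP cT'.
have emk := mk_n dvdkn.
case: ifP => [/eqP <-|nTT'].
  rewrite -(card_kpart k_gt0 (D := [set: 'Z_n] :\: T)); last first.
    by rewrite cardsDS ?subsetT // cardsT card_Zn // cT mulnBl mul1n emk.
  rewrite -card_kpart_mem ?subsetT //; apply: eq_card => W.
  by rewrite !in_set andbb.
case: ifP => [dTT'|ndTT'].
  rewrite card_kpart_mem2 ?subsetT //.
  rewrite (card_kpart k_gt0 (q := m - 2)) //.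
  rewrite cardsDS; last by rewrite subsetD subsetT disjoint_sym.
  rewrite cardsDS ?subsetT // cardsT card_Zn // cT cT' mulnBl emk; lia.
apply/eqP; rewrite cards_eq0; apply/eqP/setP => W; rewrite in_set0.
apply/negP => /setIdP[Wk /andP[TW T'W]].
by rewrite (kpart_disjoint Wk TW T'W) ?nTT' in ndTT'.
Qed.

Variable C : numClosedFieldType.

Lemma w_block_coef T i :
  w_block k C T 0 i = (T \in (enum_val i : {set {set 'Z_n}}))%:R.
Proof.
rewrite summxE /= ; under eq_bigr do rewrite mxE.
case TW: (T \in enum_val i).
  rewrite (bigD1 (enum_val i)) /=; last by rewrite enum_valP.
  by rewrite eqxx big1 ?addr0 // => W /andP[_ /negPf ne]; rewrite eq_sym ne.
rewrite big1 // => W /andP[_ TW']; case: eqP => // e.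
by rewrite e TW' in TW.
Qed.

Lemma sum_wreaths (T T' : {set 'Z_n}) :
  \sum_(i < #|wreaths n k|) (w_block k C T 0 i * w_block k C T' 0 i)
  = (gram T T')%:R.
Proof.
under eq_bigr do rewrite !w_block_coef -natrM mulnb.
rewrite -natr_sum; congr _%:R.
rewrite -(big_enum_val (A := mem (wreaths n k))
   (fun W : {set {set 'Z_n}} => ((T \in W) && (T' \in W) : nat)))%N /=.
rewrite /gram -sum1dep_card big_mkcondr /=.
by apply: eq_bigr => W _; case: (_ && _).
Qed.

Lemma dotmx_w_block (T T' : {set 'Z_n}) :
  dotmx (w_block k C T) (w_block k C T') = (gram T T')%:R.
Proof.
rewrite dotmxE mxE -sum_wreaths; apply: eq_bigr => i _; congr (_ * _).
by rewrite !mxE w_block_coef conjC_nat.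
Qed.

Lemma Phi_gram i j :
  (Phi n k C *m (Phi n k C)^T) i j = (gram (enum_val i) (enum_val j))%:R.
Proof. by rewrite -sum_wreaths mxE; apply: eq_bigr => r _; rewrite !mxE. Qed.

(** The size of the intersection of two wreaths is the number of k-sets T that
    belong to both, all members of a wreath being k-sets. *)
Lemma wreath_mx_Phi : wreath_mx n k C = (Phi n k C)^T *m Phi n k C.
Proof.
apply/matrixP => i j; rewrite !mxE.
under eq_bigr do rewrite !mxE !w_block_coef -natrM mulnb.
rewrite -natr_sum; congr _%:R.
rewrite -(big_enum_val (A := mem (ksubsets n k))
   (fun T : {set 'Z_n} => ((T \in enum_val i) && (T \in enum_val j) : nat)))%N /=.
rewrite -sum1_card [RHS]big_mkcond [LHS]big_mkcond /=.
apply: eq_bigr => T _; rewrite inE.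
case TW: (T \in enum_val i); case TW': (T \in enum_val j); rewrite /= ?if_same //.
have iW : enum_val i \in kpart k [set: 'Z_n] by rewrite -wreathsE ?enum_valP.
by have [_ /(_ T TW) cT] := kpartP _ _ _ iW; rewrite !inE cT eqxx.
Qed.

End Gram.

(** * The coefficients b *)

(** This count is used twice, for b_{l,0} and for the disjointness sums. *)
Lemma card_between_disjoint (X : finType) (A T : {set X}) (k : nat) :
  [disjoint A & T] -> (#|A| <= k)%N -> #|T| = k ->
  #|[set B : {set X} | [&& A \subset B, [disjoint B & T] & #|B| == k]]|
  = 'C(#|X| - k - #|A|, k - #|A|).
Proof.
move=> dAT leAk cT.
have sAT : A \subset ~: T by rewrite -disjoints_subset.
have := card_between (k - #|A|) sAT; rewrite subnK // (cardsCs (~: T)) setCK cT => <-.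
by apply: eq_card => B; rewrite !inE disjoints_subset.
Qed.

Section BCoef.
Variables (n k : nat).
Hypotheses (n_gt1 : (1 < n)%N) (k_gt0 : (0 < k)%N) (dvdkn : (k %| n)%N).
Hypothesis (lt2kn : (2 * k < n)%N).
Local Notation m := (n %/ k)%N.
Variable C : numClosedFieldType.

Lemma dotmx_w_set (A T : {set 'Z_n}) : T \in ksubsets n k -> 
  (0 < #|A| <= k)%N -> dotmx (w_set k C A) (w_block k C T) =
  (if A \subset T then npart k (m - 1)
   else if [disjoint A & T] then npart k (m - 2) * 'C(n - k - #|A|, k - #|A|)
   else 0)%N%:R.
Proof.
move=> Tk /andP[A_gt0 leAk]; have cT : #|T| = k by move: Tk; rewrite inE => /eqP.
have -> : dotmx (w_set k C A) (w_block k C T) =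
    (\sum_(B in ksubsets n k | A \subset B) gram k B T)%:R.
  rewrite dotmxE mulmx_suml summxE natr_sum; apply: eq_bigr => B _.
  by rewrite -dotmxE dotmx_w_block.
have nTT (B : {set 'Z_n}) : [disjoint B & T] -> B \in ksubsets n k -> (B == T) = false.
  move=> dBT; rewrite inE => /eqP cB; apply/negP => /eqP e.
  by move: dBT; rewrite e -setI_eq0 setIid -cards_eq0 cT -leqn0 leqNgt k_gt0.
congr _%:R; case: ifP => [sAT|nsAT].
  rewrite (bigD1 T) /=; last by rewrite Tk.
  rewrite gramE // eqxx big1 ?addn0 // => B /andP[/andP[Bk sAB] /negPf neBT].
  rewrite gramE // neBT; case: ifP => // dBT.
  have : A \subset B :&: T by rewrite subsetI sAB.
  by rewrite (disjoint_setI0 dBT) subset0 -cards_eq0 -leqn0 leqNgt A_gt0.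
have neBT (B : {set 'Z_n}) : A \subset B -> (B == T) = false.
  by move=> sAB; apply/negP => /eqP e; rewrite -e sAB in nsAT.
case: ifP => dAT; last first.
  apply: big1 => B /andP[Bk sAB]; rewrite gramE // neBT //.
  case: ifP => // dBT; move: dAT.
  by rewrite (disjointWl sAB dBT).
rewrite -[X in 'C(X - k - _, _)]card_Zn // -(card_between_disjoint dAT) //.
rewrite mulnC -sum_nat_const big_mkcond [RHS]big_mkcond /=.
apply: eq_bigr => B _; case Bk: (B \in ksubsets n k) => /=; last first.
  by move: Bk; rewrite !inE => ->; rewrite !andbF.
have := Bk; rewrite !inE => ->; case sAB: (A \subset B) => //=.
by rewrite andbT gramE // neBT.
Qed.

(** The bound on p + q excludes wrap-around modulo n. *)
Lemma mem_interval p q (x : 'Z_n) : (p + q < n)%N ->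
  (x \in Defs.interval n p q) = (p < x <= p + q)%N.
Proof.
move=> ltn; apply/imsetP/andP => [[r _ ->]|[ltpx lexpq]].
  by have ltr := ltn_ord r; rewrite val_Zp_nat // modn_small; [split; lia|lia].
have ltr : (x - p.+1 < q)%N by lia.
exists (Ordinal ltr) => //=; rewrite (_ : p + _ = x)%N ?natr_Zp //; lia.
Qed.

Lemma card_interval p q : (p + q < n)%N -> #|Defs.interval n p q| = q.
Proof.
move=> ltn; rewrite card_imset ?card_ord // => r r' /(congr1 val) /=.
rewrite !val_Zp_nat //; have := ltn_ord r; have := ltn_ord r' => lr lr'.
rewrite !modn_small; [|lia|lia] => e; apply: val_inj => /=; lia.
Qed.

Lemma b_coefE l j : (0 < l <= k)%N -> (j <= l)%N -> b_coef n k C l j =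
  (if j == 0 then npart k (m - 2) * 'C(n - k - l, k - l)
   else if j < l then 0 else npart k (m - 1))%N%:R.
Proof.
move=> /andP[l_gt0 lelk] lejl.
have cA : #|Defs.interval n 0 l| = l by rewrite card_interval //; lia.
have cT : Defs.interval n (l - j) k \in ksubsets n k.
  by rewrite inE card_interval //; lia.
rewrite /b_coef dotmx_w_set // cA ?l_gt0 //; congr _%:R.
have memA x : (x \in Defs.interval n 0 l) = (0 < x <= l)%N.
  by rewrite mem_interval ?add0n //; lia.
have memT x : (x \in Defs.interval n (l - j) k) = (l - j < x <= l - j + k)%N.
  by rewrite mem_interval //; lia.
have valZ p : (p < n)%N -> (p%:R : 'Z_n) = p :> nat.
  by move=> ltpn; rewrite val_Zp_nat // modn_small.
have -> : (Defs.interval n 0 l \subset Defs.interval n (l - j) k) = (j == l).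
  apply/subsetP/eqP => [/(_ 1)|ejl x]; last by rewrite memA memT; lia.
  rewrite memA memT -[1]/(1%:R) valZ //; lia.
have -> : [disjoint Defs.interval n 0 l & Defs.interval n (l - j) k] = (j == 0%N).
  apply/pred0P/eqP => [/(_ l%:R)|ejl x] /=; rewrite memA memT ?valZ; lia.
by case: (ltngtP j l) lejl => //= ->; case: eqP => //; lia.
Qed.

Lemma npartE q : (npart k q)%:R = (q * k)`!%:R / (k`!%:R ^+ q * q`!%:R) :> C.
Proof.
rewrite -(npart_fact k_gt0) natrM !natrM natrX mulfK //.
by rewrite mulf_neq0 ?expf_neq0 // pnatr_eq0 -lt0n fact_gt0.
Qed.

End BCoef.

(** * Disjointness sums of symmetric functions on subsets *)

Section SymmetricFunctions.
Variables (X : finType) (C : numDomainType) (f : {set X} -> C).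

Lemma mem_imset_tperm (x y z : X) (T : {set X}) :
  (z \in tperm x y @: T) = (tperm x y z \in T).
Proof. by rewrite -{1}(tpermK x y z) mem_imset //; apply: perm_inj. Qed.

Lemma tperm_imset_fix (x y : X) (T : {set X}) :
  (x \in T) = (y \in T) -> tperm x y @: T = T.
Proof.
by move=> e; apply/setP => z; rewrite mem_imset_tperm; case: tpermP => [->|->|].
Qed.

(** A and B differ outside P only.  Exchanging a point of A :\: B with a point
    of B :\: A brings A closer to B without changing the value of f. *)
Lemma sym_outside (P A B : {set X}) :
    (forall x y (T : {set X}), x \notin P -> y \notin P -> f (tperm x y @: T) = f T) ->
  #|A| = #|B| -> A :&: P = B :&: P -> f A = f B.
Proof.
move=> sym; move: {2}#|A :\: B| (leqnn #|A :\: B|) => r.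
elim: r A => [|r IHr] A leAr cAB eAB.
  suff -> : A = B by [].
  apply/eqP; rewrite eqEcard cAB leqnn andbT -setD_eq0 -cards_eq0.
  by rewrite -leqn0.
have [AB0|[x xAB]] := set_0Vmem (A :\: B).
  by apply: IHr => //; rewrite AB0 cards0.
have cBA : #|B :\: A| = #|A :\: B|.
  by rewrite !cardsD cAB (setIC B A).
have [y yBA] : exists y, y \in B :\: A.
  by apply/card_gt0P; rewrite cBA; apply/card_gt0P; exists x.
move: (xAB) (yBA); rewrite !inE => /andP[xB xA] /andP[yA yB].
have /setP eP := eAB.
have xP : x \notin P by have := eP x; rewrite !inE xA (negPf xB) /= => ->.
have yP : y \notin P by have := eP y; rewrite !inE yB (negPf yA) /= => <-.
rewrite -(sym x y A) //; apply: IHr.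
- rewrite -ltnS; apply: leq_trans leAr; apply: proper_card; apply/properP.
  split.
    apply/subsetP => z; rewrite !inE mem_imset_tperm => /andP[zB].
    by rewrite zB /=; case: tpermP zB => [->|->|//]; rewrite ?yB ?xA.
  by exists x => //; rewrite !inE mem_imset_tperm tpermL (negPf yA) andbF.
- by rewrite card_imset //; apply: perm_inj.
- rewrite -eAB; apply/setP => z; rewrite !inE mem_imset_tperm.
  by case: tpermP => [->|->|//]; rewrite ?(negPf xP) ?(negPf yP) !andbF.
Qed.

(** From here on, a c and b c are the two entries of the c-th of the first l
    columns of a two-row tableau. *)
Variables (l : nat) (a b : 'I_l -> X).
Hypotheses (a_inj : injective a) (b_inj : injective b).
Hypothesis ab_neq : forall c d, a c != b d.

Definition paired : {set X} := [set a c | c in 'I_l] :|: [set b c | c in 'I_l].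

Lemma pairedP x :
  reflect (exists c, x = a c \/ x = b c) (x \in paired).
Proof.
apply: (iffP setUP) => [[/imsetP[c _ ->]|/imsetP[c _ ->]]|[c [->|->]]].
- by exists c; left.
- by exists c; right.
- by left; apply: imset_f.
- by right; apply: imset_f.
Qed.

Hypothesis f_sym : forall x y (T : {set X}), x \notin paired -> y \notin paired ->
  f (tperm x y @: T) = f T.
Hypothesis f_anti : forall c (T : {set X}), f (tperm (a c) (b c) @: T) = - f T.

Definition swap (r : seq 'I_l) : {perm X} := (\prod_(c <- r) tperm (a c) (b c))%g.

Lemma swap_act r (T : {set X}) : f (swap r @: T) = (-1) ^+ size r * f T.
Proof.
elim: r T => [|c r IHr] T; rewrite /swap ?big_nil ?big_cons.
  rewrite mul1r; congr f; rewrite -[RHS]imset_id.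
  by apply: eq_imset => x; rewrite perm1.
have -> : (tperm (a c) (b c) * \prod_(d <- r) tperm (a d) (b d))%g @: T =
    swap r @: (tperm (a c) (b c) @: T).
  by rewrite -imset_comp; apply: eq_imset => x; rewrite permM.
by rewrite IHr f_anti exprS mulN1r mulrN mulNr.
Qed.

Lemma swap_ab r c : uniq r ->
  swap r (a c) = (if c \in r then b c else a c) /\
  swap r (b c) = (if c \in r then a c else b c).
Proof.
rewrite /swap; elim: r => [|d r IHr] /=; first by rewrite big_nil !perm1.
case/andP=> dr /IHr[IHa IHb]; rewrite big_cons !permM inE.
case: eqVneq => [<-|ne] in dr *.
  by rewrite tpermL tpermR IHa IHb (negPf dr).
by rewrite !tpermD // ?ab_neq // 1?eq_sym ?ab_neq // ?(inj_eq a_inj) ?(inj_eq b_inj).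
Qed.

(** The involution that exchanges a c with b c for every c. *)
Let sigma := swap (enum 'I_l).

Lemma sigma_a c : sigma (a c) = b c.
Proof. by have [-> _] := swap_ab c (enum_uniq 'I_l); rewrite mem_enum. Qed.

Lemma sigma_b c : sigma (b c) = a c.
Proof. by have [_ ->] := swap_ab c (enum_uniq 'I_l); rewrite mem_enum. Qed.

Lemma mem_sigma_a c (T : {set X}) : (a c \in sigma @: T) = (b c \in T).
Proof. by rewrite -sigma_b mem_imset //; apply: perm_inj. Qed.

Lemma mem_sigma_b c (T : {set X}) : (b c \in sigma @: T) = (a c \in T).
Proof. by rewrite -sigma_a mem_imset //; apply: perm_inj. Qed.

(** The transposition of a c and b c fixes T, yet changes the sign of f. *)
Lemma anti_vanish c (T : {set X}) : (a c \in T) = (b c \in T) -> f T = 0.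
Proof.
move=> /tperm_imset_fix e; have := f_anti c T; rewrite e => /eqP.
by rewrite -addr_eq0 -mulr2n mulrn_eq0 /= => /eqP.
Qed.

(** By hypothesis T' and the image of T under sigma agree on the pairs, hence f
    takes the same value on both; and sigma is made of l sign changes. *)
Lemma f_complement  (T T' : {set X}) : #|T| = #|T'| ->
    (forall c, (a c \in T) != (b c \in T)) ->
    T' :&: paired = paired :\: T ->
  f T' = (-1) ^+ l * f T.
Proof.
move=> cTT' good eT'.
have -> : (-1) ^+ l * f T = f (sigma @: T) by rewrite swap_act -cardE card_ord.
apply: (sym_outside (P := paired) f_sym).
  by rewrite card_imset //; apply: perm_inj.
rewrite eT'; apply/setP => x; rewrite in_setD in_setI.
case xP: (x \in paired); rewrite ?andbF ?andbT //.
have /pairedP[c [->|->]] := xP.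
  by rewrite mem_sigma_a; have := good c; case: (a c \in T); case: (b c \in T).
by rewrite mem_sigma_b; have := good c; case: (a c \in T); case: (b c \in T).
Qed.

Lemma card_paired_half (T : {set X}) : (forall c, (a c \in T) != (b c \in T)) ->
  #|paired :\: T| = l.
Proof.
move=> good.
have -> : paired :\: T = [set if a c \in T then b c else a c | c : 'I_l].
  apply/setP => x; rewrite inE; apply/andP/imsetP.
    case=> xT /pairedP[c [e|e]]; exists c => //; rewrite e in xT *.
      by rewrite (negPf xT).
    by have := good c; rewrite (negPf xT); case: (a c \in T).
  case=> c _ ->; have := good c; case: ifP => [aT|aT]; case bT: (b c \in T) => // _.
    by split=> //; apply/pairedP; exists c; right.
  by rewrite aT; split=> //; apply/pairedP; exists c; left.
rewrite card_imset ?card_ord // => c d; case: ifP => _; case: ifP => _ /eqP.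
- by move/eqP/b_inj.
- by rewrite eq_sym (negPf (ab_neq _ _)).
- by rewrite (negPf (ab_neq _ _)).
- by move/eqP/a_inj.
Qed.

(** If T contains exactly one element of each pair, a set T' disjoint from T
    contributes only if it contains all the other elements of the pairs.
    Otherwise some transposition of a pair fixes T, and both sides vanish. *)
Lemma kneser_sum k (T : {set X}) : (l <= k)%N -> #|T| = k ->
  \sum_(T' : {set X} | (#|T'| == k) && [disjoint T' & T]) f T' =
  (-1) ^+ l * 'C(#|X| - k - l, k - l)%:R * f T.
Proof.
move=> lelk cT.
have [/forallP good|] := boolP [forall c, (a c \in T) != (b c \in T)].
  have cPT := card_paired_half good.
  have dPT : [disjoint paired :\: T & T].
    by rewrite disjoints_subset setDE subsetIr.
  rewrite (bigID (fun T' : {set X} => paired :\: T \subset T')) /= addrC big1.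
    rewrite add0r; have := card_between_disjoint dPT; rewrite cPT => <- //.
    rewrite mulrAC mulr_natr -sumr_const.
    apply: eq_big => T' /=; first by rewrite in_set andbC (andbC (_ == _)).
    case/andP=> /andP[/eqP cT' dTT'] sPT'.
    apply: f_complement => //; first by rewrite cT.
    apply/eqP; rewrite eqEsubset subsetI sPT' subsetDl !andbT.
    apply/subsetP => x /setIP[xT' xP]; rewrite inE xP andbT.
    by have /pred0P/(_ x) := dTT'; rewrite /= xT' /= => ->.
  move=> T' /andP[/andP[_ dTT'] /subsetPn[x /setDP[xP xT] xT']].
  have disj y : y \in T -> y \in T' = false.
    by move=> yT; have /pred0P/(_ y) := dTT'; rewrite /= yT andbT.
  have /pairedP[c ec] := xP; apply: (@anti_vanish c).
  have := good c; case: ec => e; rewrite e in xT xT'.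
    by rewrite (negPf xT) (negPf xT') eq_sym eqbF_neg negbK => /disj ->.
  by rewrite (negPf xT) (negPf xT') eqbF_neg negbK => /disj ->.
rewrite negb_forall => /existsP[c /negPn/eqP eT].
rewrite (anti_vanish eT) mulr0.
(* The transposition of the pair c permutes the sets disjoint from T. *)
set S := \sum_(T' | _) _.
suff : S = - S by move/eqP; rewrite -addr_eq0 -mulr2n mulrn_eq0 /= => /eqP.
have inj : injective (fun T' : {set X} => tperm (a c) (b c) @: T').
  by apply: imset_inj; apply: perm_inj.
rewrite {1}/S (reindex_inj inj) /= -sumrN; apply: eq_big => T' /=.
  rewrite card_imset; last exact: perm_inj.
  congr andb; rewrite -{1}(tperm_imset_fix eT) -!setI_eq0 -imsetI.
    by rewrite imset_eq0.
  by move=> x y _ _; apply: perm_inj.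
by rewrite f_anti.
Qed.

End SymmetricFunctions.

(** * Symmetries of two-row polytabloids *)

Section Polytabloids.
Variables (F : fieldType) (X : finType) (lam : seq nat).
Implicit Types t : {ffun X -> 'I_#|X| * 'I_#|X|}.
Local Notation e_ t := (polytabloid F lam t).

Lemma tableau_inj t : t \in tableaux X lam -> injective t.
Proof. by rewrite inE => /andP[/injectiveP]. Qed.

Lemma tableau_cell t x : t \in tableaux X lam ->
  ((t x).2 < nth 0%N lam (t x).1)%N.
Proof. by rewrite inE => /andP[_ /forallP]. Qed.

Lemma column_stabP t (s : {perm X}) :
  reflect (forall x, (t (s x)).2 = (t x).2) (s \in column_stab t).
Proof. by rewrite inE; apply: (iffP forallP) => h x; apply/eqP. Qed.

Lemma column_stabV t (s : {perm X}) x : s \in column_stab t ->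
  (t (s^-1%g x)).2 = (t x).2.
Proof. by move=> /column_stabP h; rewrite -{2}(permKV s x) h. Qed.

Lemma polytabloid_column t (s : {perm X}) : s \in column_stab t ->
  e_ (ffun_act t s) = (-1) ^+ s *: e_ t.
Proof.
move=> sC; rewrite scaler_sumr [RHS](reindex_inj (mulgI s)) /=.
apply: eq_big => [u|u _]; last first.
  by rewrite -ffun_actM scalerA odd_permM signr_addb mulrA -expr2 sqrr_sign mul1r.
apply/column_stabP/column_stabP => h x.
  by have := h (s x); rewrite !ffunE permM permK (column_stabV _ sC).
by rewrite !ffunE !(column_stabV _ sC) -{1}(permKV s x) -permM h (column_stabV _ sC).
Qed.

(** Being alone in their columns, x and y are fixed by the column stabilizer of
    t, so exchanging them commutes with it; being in the same row, their exchange
    does not change the tabloid of t. *)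
Lemma polytabloid_swap_row t x y : t \in tableaux X lam ->
    (t x).1 = (t y).1 ->
    (forall z, (t z).2 = (t x).2 -> z = x) ->
    (forall z, (t z).2 = (t y).2 -> z = y) ->
  e_ t *m tabloid_repr F X lam (tperm x y) = e_ t.
Proof.
move=> tP rxy cx cy; rewrite mulmx_suml; apply: eq_bigr => u uC.
rewrite -scalemxAl (basis_vec_permod F (tabloids_acts X lam)) ?inE //=; last first.
  by apply: imset_f; rewrite tableaux_act.
congr (_ *: basis_vec _ _ _); apply/ffunP => z; rewrite !ffunE tpermV.
have fixV w : (forall z, (t z).2 = (t w).2 -> z = w) -> u^-1%g w = w.
  by move=> h; apply: h; apply: column_stabV.
by case: tpermP => // ->; rewrite (fixV _ cx) (fixV _ cy) rxy.
Qed.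

(** The tabloid of t occurs in the polytabloid with coefficient 1: a permutation
    that preserves both the rows and the columns of t is the identity. *)
Lemma polytabloid_neq0 t : t \in tableaux X lam -> e_ t != 0.
Proof.
move=> tP; have tT : tabloid t \in tabloids X lam by apply: imset_f.
apply/eqP => /rowP/(_ (enum_rank_in tT (tabloid t))).
rewrite summxE (bigD1 1%g) /=; last by apply/column_stabP => x; rewrite perm1.
rewrite !mxE ffun_act1 enum_rankK_in // eqxx odd_perm1 mul1r big1 ?addr0.
  by move/eqP; rewrite oner_eq0.
move=> s /andP[sC s1]; rewrite !mxE enum_rankK_in //; case: eqP => [e|]; last first.
  by rewrite mulr0.
case/eqP: s1; apply/permP => x; rewrite perm1.
suff e' : s^-1%g x = x by rewrite -{1}e' permKV.
apply: (tableau_inj tP); have /ffunP/(_ x) := e; rewrite !ffunE => e1.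
by rewrite [LHS]surjective_pairing -e1 (column_stabV _ sC) -surjective_pairing.
Qed.

Lemma polytabloid_sub t : t \in tableaux X lam -> (e_ t <= specht_mx F X lam)%MS.
Proof. by move=> tP; apply: (sumsmx_sup t); rewrite ?genmxE. Qed.

Lemma specht_neq0 t : t \in tableaux X lam -> specht_mx F X lam != 0.
Proof.
move=> tP; apply: contraNneq (polytabloid_neq0 tP) => e.
by have := polytabloid_sub tP; rewrite e submx0.
Qed.

End Polytabloids.

Lemma sum_nth_sumn (s : seq nat) n : (\sum_(i < n) nth 0%N s i <= sumn s)%N.
Proof.
elim: s n => [|x s IHs] n.
  by rewrite big1 // => i _; rewrite nth_nil.
case: n => [|n]; first by rewrite big_ord0.
by rewrite big_ord_recl /= leq_add2l; apply: IHs.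
Qed.

Lemma sum_ltn_minn n q : (\sum_(c < n) (c < q) = minn n q)%N.
Proof. elim: n => [|n IHn]; rewrite ?big_ord0 ?min0n // big_ord_recr /= IHn; lia. Qed.

Section TwoRows.
Variables (X : finType) (N l : nat).
Hypotheses (cardX : #|X| = N) (l_gt0 : (0 < l)%N) (le2lN : (l <= N - l)%N).
Local Notation lam := [:: (N - l)%N; l].

(** A tableau is an injection into the cells of its diagram, of which there are
    at most N. *)
Lemma tableau_surj (t : {ffun X -> 'I_#|X| * 'I_#|X|}) : t \in tableaux X lam ->
  forall r c : nat, (c < nth 0%N lam r)%N ->
  exists x, (t x).1 = r :> nat /\ (t x).2 = c :> nat.
Proof.
move=> tP r c ltc.
have ltr : (r < 2)%N by move: ltc; case: r => [|[|r]] //=; rewrite nth_nil.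
have ltrX : (r < #|X|)%N by lia.
have ltcX : (c < #|X|)%N.
  by move: ltc ltr; rewrite cardX; case: r {ltrX} => [|[|r]] /= *; lia.
pose cells := [set p : 'I_#|X| * 'I_#|X| | (p.2 < nth 0%N lam p.1)%N].
have sub : t @: X \subset cells.
  by apply/subsetP => _ /imsetP[x _ ->]; rewrite inE tableau_cell.
have card_cells : (#|cells| <= #|X|)%N.
  rewrite -sum1dep_card big_mkcond /=.
  rewrite -(pair_bigA _ (fun r c : 'I_#|X| => if (c < nth 0%N lam r)%N then 1 else 0)%N) /=.
  apply: (@leq_trans (\sum_(r < #|X|) nth 0%N lam r)).
    apply: leq_sum => i _; apply: leq_trans (geq_minr #|X| _).
    by rewrite -sum_ltn_minn; apply: leq_sum => j _; case: ifP.
  by apply: leq_trans (sum_nth_sumn _ _) _; rewrite /= cardX; lia.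
have : t @: X = cells.
  by apply/eqP; rewrite eqEcard sub card_imset //; apply: tableau_inj tP.
move/setP/(_ (Ordinal ltrX, Ordinal ltcX)); rewrite [in RHS]inE /= ltc.
by case/imsetP=> x _ e; exists x; rewrite -e.
Qed.

(** The columns of index c < l have height 2 and entries a c, b c; the elements
    outside them lie in row 0 and are alone in their columns. *)
Lemma tableau_columns (t : {ffun X -> 'I_#|X| * 'I_#|X|}) : t \in tableaux X lam ->
  exists a b : 'I_l -> X,
   [/\ injective a, injective b, (forall c d, a c != b d),
       (forall c, tperm (a c) (b c) \in column_stab t)
     & forall x, x \notin paired a b ->
       (t x).1 = 0%N :> nat /\ (forall z, (t z).2 = (t x).2 -> z = x)].
Proof.
move=> tP; have surj := tableau_surj tP.
have /fin_all_exists[a aP] : forall c : 'I_l, exists x,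
    (t x).1 = 0%N :> nat /\ (t x).2 = c :> nat.
  by move=> c; apply: surj; have := ltn_ord c => /=; lia.
have /fin_all_exists[b bP] : forall c : 'I_l, exists x,
    (t x).1 = 1%N :> nat /\ (t x).2 = c :> nat.
  by move=> c; apply: surj => /=.
have ext x y : (t x).1 = (t y).1 :> nat -> (t x).2 = (t y).2 :> nat -> x = y.
  move=> /val_inj e1 /val_inj e2; apply: (tableau_inj tP).
  by rewrite [LHS]surjective_pairing e1 e2 -surjective_pairing.
exists a, b; split.
- by move=> c d e; apply: val_inj => /=; rewrite -(proj2 (aP c)) e (proj2 (aP d)).
- by move=> c d e; apply: val_inj => /=; rewrite -(proj2 (bP c)) e (proj2 (bP d)).
- move=> c d; apply/eqP => e; have := proj1 (aP c).
  by rewrite e (proj1 (bP d)).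
- move=> c; apply/column_stabP => x; apply: val_inj => /=.
  by case: tpermP => [->|->|//]; rewrite (proj2 (aP c)) (proj2 (bP c)).
have short x : ((t x).2 < l)%N -> x \in paired a b.
  move=> ltl; have := tableau_cell x tP; case e: ((t x).1 : nat) => [|[|r]] /=.
  - move=> _; apply/pairedP; exists (Ordinal ltl); left.
    by apply: ext; rewrite ?(proj1 (aP _)) ?(proj2 (aP _)).
  - move=> _; apply/pairedP; exists (Ordinal ltl); right.
    by apply: ext; rewrite ?(proj1 (bP _)) ?(proj2 (bP _)).
  - by rewrite nth_nil.
have long x : (l <= (t x).2)%N -> (t x).1 = 0%N :> nat.
  move=> gel; have := tableau_cell x tP; case e: ((t x).1 : nat) => [|[|r]] //=.
    by rewrite ltnNge gel.
  by rewrite nth_nil.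
move=> x xP; have gel : (l <= (t x).2)%N by rewrite leqNgt; apply: contra xP => /short.
split=> [|z ez]; first exact: long.
by apply: ext; rewrite ?ez // !long // ez.
Qed.

Lemma tableau_exists : exists t, t \in tableaux X lam.
Proof.
have lt0 : (0 < #|X|)%N by lia.
have lt1 : (1 < #|X|)%N by lia.
have ltc (i : 'I_#|X|) : (i - (N - l) < #|X|)%N by have := ltn_ord i; lia.
pose t : {ffun X -> 'I_#|X| * 'I_#|X|} := [ffun x =>
  if (enum_rank x < N - l)%N then (Ordinal lt0, enum_rank x)
  else (Ordinal lt1, Ordinal (ltc (enum_rank x)))].
exists t; rewrite inE; apply/andP; split.
  apply/injectiveP => x y; rewrite !ffunE; case: ifP => hx; case: ifP => hy.
  - by case=> /enum_rank_inj.
  - by case.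
  - by case.
  - move=> [] e; apply: enum_rank_inj; apply: ord_inj.
    move/negbT: hx; move/negbT: hy; rewrite -!leqNgt => hy hx.
    by rewrite -(subnK hx) e subnK.
apply/forallP => x; rewrite ffunE; case: ifP => hx //=.
move/negbT: hx; rewrite -leqNgt => hx; rewrite ltn_subLR // subnK; last by lia.
by rewrite -[X in (_ < X)%N]cardX ltn_ord.
Qed.

End TwoRows.

(** * The eigenvalue on a Specht submodule *)

Section SubmoduleIso.
Variables (F : fieldType) (gT : finGroupType) (G : {group gT}) (n1 n2 : nat).
Variables (rG1 : mx_representation F G n1) (rG2 : mx_representation F G n2).
Variables (U : 'M[F]_n1) (V : 'M[F]_n2).
Variables (modU : mxmodule rG1 U) (modV : mxmodule rG2 V).
Hypothesis simUV : mx_rsim (submod_repr modU) (submod_repr modV).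

(** An isomorphism between submodules of two representations is given by a single
    matrix between the ambient spaces, which avoids working with coordinates in
    the submodules; it intertwines the actions on V only. *)
Lemma mx_rsim_submod_map : exists2 h : 'M_(n2, n1), (V *m h :=: U)%MS &
  forall x (v : 'rV_n2), x \in G -> (v <= V)%MS ->
    v *m h *m rG1 x = v *m rG2 x *m h.
Proof.
have [f ef ff hom] := mx_rsim_sym simUV.
have full_f : row_full f by move: ff; rewrite /row_free /row_full => /eqP ->; rewrite ef.
have hE m (v : 'M_(m, n2)) : v *m (in_submod V 1%:M *m f *m val_submod 1%:M) =
    val_submod (in_submod V v *m f) :> 'M_(m, n1).
  by rewrite [RHS]val_submodE [in_submod V v]in_submodE !mulmxA.
exists (in_submod V 1%:M *m f *m val_submod 1%:M) => [|x v xG vV].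
  rewrite hE; apply: (eqmx_trans _ (val_submod1 U)).
  apply/eqmxP; rewrite !val_submodS submx1 /=.
  have VV : (1%:M <= in_submod V V)%MS.
    by rewrite -val_submodS in_submodK // val_submod1.
  apply: (@submx_trans _ _ _ _ _ _ f); first by rewrite sub1mx.
  by have := submxMr f VV; rewrite mul1mx.
rewrite !hE -val_submodJ // in_submodJ //; congr (val_submod _).
rewrite -[LHS]mulmxA -[RHS]mulmxA; congr (_ *m _); exact: (esym (hom x xG)).
Qed.

End SubmoduleIso.

Section Coordinates.
Variables (n k : nat) (C : numClosedFieldType).
Local Notation ksub := (ksubsets n k).

(** The value at T of u seen as a function on sets, extended by 0 to the sets that
    do not have k elements. *)
Definition coef (u : 'rV[C]_#|ksub|) (T : {set 'Z_n}) : C :=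
  (u *m (basis_vec C ksub T)^T) 0 0.

Lemma coef_enum u i : coef u (enum_val i) = u 0 i.
Proof.
rewrite /coef mxE (bigD1 i) //= !mxE eqxx mulr1 big1 ?addr0 // => j ne.
by rewrite !mxE (inj_eq enum_val_inj) (negPf ne) mulr0.
Qed.

Lemma coefN u T : coef (- u) T = - coef u T.
Proof. by rewrite /coef mulNmx mxE. Qed.

Lemma coef_act u (s : {perm 'Z_n}) (T : {set 'Z_n}) :
  coef (u *m Vk_repr n k C s) (s @: T) = coef u T.
Proof.
rewrite /coef -mulmxA; congr ((_ *m _) 0 0); apply/colP => i.
have sE (S : {set 'Z_n}) : ('P^*)%act S s = s @: S.
  by apply: eq_imset => x; rewrite /= apermE.
have iS : s @: enum_val i \in ksub.
  rewrite inE card_imset; last exact: perm_inj.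
  by have := enum_valP i; rewrite inE.
rewrite mxE (bigD1 (enum_rank_in iS (s @: enum_val i))) //= big1 => [|j ne].
  rewrite !mxE enum_rankK_in // sE eqxx mul1r addr0.
  by rewrite (inj_eq (imset_inj (@perm_inj _ s))).
rewrite !mxE sE; case: eqP => [e|]; last by rewrite mul0r.
by case/eqP: ne; apply: enum_val_inj; rewrite enum_rankK_in.
Qed.

End Coordinates.

Section Eigenvalue.
Variables (n k l : nat).
Hypotheses (n_gt1 : (1 < n)%N) (k_gt0 : (0 < k)%N) (dvdkn : (k %| n)%N).
Hypotheses (lt2kn : (2 * k < n)%N) (le2l : (2 <= l)%N) (lelk : (l <= k)%N).
Local Notation m := (n %/ k)%N.
Local Notation lam := [:: (n - l)%N; l].
Variable C : numClosedFieldType.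

Definition eigenval : C := (npart k (m - 1))%:R
  + (-1) ^+ l * (npart k (m - 2) * 'C(n - k - l, k - l))%:R.

(** N (m - 1) = N (m - 2) C(n - k - 1, k - 1), and the binomial coefficients
    C(a + c, b + c) do not decrease with c; the last step, from c = l - 2 to
    l - 1, is a strict increase, which is where l >= 2 is used. *)
Lemma npart_lt : (npart k (m - 2) * 'C(n - k - l, k - l) < npart k (m - 1))%N.
Proof.
have emk := mk_n dvdkn.
have m_gt2 : (2 < m)%N by rewrite -(ltn_pmul2r k_gt0) emk.
have -> : (m - 1 = (m - 2).+1)%N by lia.
have npart_gt0 q : (0 < npart k q)%N.
  by have := fact_gt0 (q * k); rewrite -(npart_fact k_gt0) muln_gt0 => /andP[].
rewrite [X in (_ < X)%N]/npart big_ord_recr /= -/(npart k (m - 2)) ltn_pmul2l //.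
have -> : ((m - 2).+1 * k = n - k)%N.
  by rewrite (_ : (m - 2).+1 = m - 1)%N ?mulnBl ?mul1n ?emk //; lia.
have bin_mono a b c : ('C(a, b) <= 'C(a + c, b + c))%N.
  elim: c => [|c IHc]; rewrite ?addn0 // !addnS binS.
  by apply: leq_trans IHc _; apply: leq_addl.
have := bin_mono (n - k - l)%N (k - l)%N (l - 2)%N.
have -> : (n - k - l + (l - 2) = n - k - 2)%N by lia.
have -> : (k - l + (l - 2) = k - 2)%N by lia.
move=> le1; apply: leq_ltn_trans le1 _.
have -> : ((n - k).-1 = (n - k - 2).+1)%N by lia.
have -> : (k.-1 = (k - 2).+1)%N by lia.
by rewrite binS -addn1 addnC leq_add2r bin_gt0; lia.
Qed.

Lemma eigenval_neq0 : eigenval != 0.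
Proof.
have lt := npart_lt; rewrite /eigenval -signr_odd; case: (odd l).
  by rewrite expr1 mulN1r subr_eq0 eqr_nat neq_ltn lt orbT.
by rewrite mul1r -natrD pnatr_eq0 -lt0n; lia.
Qed.

Local Notation Gram := (Phi n k C *m (Phi n k C)^T).

(** Row T of the Gram matrix is the sum of a multiple of the unit vector at T and of
    the indicator of the k-sets disjoint from T, so that [kneser_sum] applies. *)
Lemma gram_eigen (u : 'rV[C]_#|ksubsets n k|) (a b : 'I_l -> 'Z_n) :
    injective a -> injective b -> (forall c d, a c != b d) ->
    (forall c, u *m Vk_repr n k C (tperm (a c) (b c)) = - u) ->
    (forall x y, x \notin paired a b -> y \notin paired a b ->
       u *m Vk_repr n k C (tperm x y) = u) ->
  u *m Gram = eigenval *: u.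
Proof.
move=> a_inj b_inj ab_neq anti sym; apply/rowP => j.
have f_anti c (T : {set 'Z_n}) : coef u (tperm (a c) (b c) @: T) = - coef u T.
  have := coef_act u (tperm (a c) (b c)) T; rewrite anti => <-.
  by rewrite coefN opprK.
have f_sym x y (T : {set 'Z_n}) : x \notin paired a b -> y \notin paired a b ->
    coef u (tperm x y @: T) = coef u T.
  by move=> xP yP; have := coef_act u (tperm x y) T; rewrite sym.
have jk := enum_valP j; set T := enum_val j in jk.
have cT : #|T| = k by move: jk; rewrite inE => /eqP.
have := kneser_sum a_inj b_inj ab_neq f_sym f_anti lelk cT.
rewrite card_Zn // => kn.
rewrite !mxE -(coef_enum u j) -/T.
transitivity (\sum_(S in ksubsets n k) coef u S * (gram k S T)%:R).
  rewrite [RHS]big_enum_val; apply: eq_bigr => i _.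
  by rewrite Phi_gram coef_enum.
rewrite (bigD1 T) //= gramE // eqxx.
rewrite /eigenval mulrDl [in RHS]mulrC; congr (_ + _).
transitivity ((npart k (m - 2))%:R *
    \sum_(S : {set 'Z_n} | (#|S| == k) && [disjoint S & T]) coef u S); last first.
  by rewrite kn natrM; ring.
rewrite mulr_sumr big_mkcondr /= [LHS]big_mkcond [RHS]big_mkcond /=.
apply: eq_bigr => S _; rewrite [S \in _]inE; case cS: (#|S| == k) => //=.
have Sk : S \in ksubsets n k by rewrite inE.
case: eqVneq => [->|ne] /=.
  by case: ifP => //; rewrite -setI_eq0 setIid -cards_eq0 cT -leqn0 leqNgt k_gt0.
by rewrite gramE // (negPf ne); case: ifP => _; [exact: mulrC | exact: mulr0].
Qed.

Variable U : 'M[C]_#|ksubsets n k|.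
Variable modU : mxmodule (Vk_repr n k C) U.
Hypothesis simU : mx_rsim (submod_repr modU) (specht_repr C 'Z_n lam).

(** The images of the polytabloids span U, and each of them has the symmetries
    that [gram_eigen] requires. *)
Lemma specht_gram : U *m Gram = eigenval *: U.
Proof.
have [h Uh hom] := mx_rsim_submod_map simU.
have tab t : t \in tableaux 'Z_n lam ->
    polytabloid C lam t *m h *m Gram = eigenval *: (polytabloid C lam t *m h).
  move=> tP.
  have le2l' : (l <= n - l)%N by lia.
  have [a [b [a_inj b_inj ab ab_col out]]] :=
    tableau_columns (card_Zn n_gt1) (ltnW le2l) le2l' tP.
  apply: (gram_eigen a_inj b_inj ab) => [c|x y xP yP].
    rewrite hom ?inE ?polytabloid_sub // polytabloid_act // polytabloid_column //.
    rewrite odd_tperm ab expr1 -scalemxAl scaleN1r //.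
  rewrite hom ?inE ?polytabloid_sub //; congr (_ *m h).
  have [rx cx] := out x xP; have [ry cy] := out y yP.
  by apply: polytabloid_swap_row => //; apply: val_inj; rewrite /= rx ry.
suff : (specht_mx C 'Z_n lam *m h <= kermx (Gram - eigenval%:M))%MS.
  rewrite Uh => /sub_kermxP; rewrite mulmxBr mul_mx_scalar => /eqP.
  by rewrite subr_eq0 => /eqP.
rewrite /specht_mx sumsmxMr_gen; apply/sumsmx_subP => t tP.
rewrite genmxE (eqmxMr _ (genmxE _)); apply/sub_kermxP.
by rewrite mulmxBr mul_mx_scalar tab // subrr.
Qed.

Lemma specht_sub_neq0 : U != 0.
Proof.
rewrite -mxrank_eq0 (mxrank_rsim simU) mxrank_eq0.
have [t tP] : exists t, t \in tableaux 'Z_n lam.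
  by apply: (tableau_exists (card_Zn n_gt1)); lia.
exact: specht_neq0 tP.
Qed.

(** U Phi M = (U Phi Phi^T) Phi = c U Phi with c = eigenval.  This image is nonzero
    since applying Phi^T to it gives c U. *)
Lemma specht_image_eigenspace (a : C) :
  (U *m Phi n k C <= eigenspace (wreath_mx n k C) a)%MS <-> a = eigenval.
Proof.
have E0 : U *m Phi n k C != 0.
  apply: contraNneq specht_sub_neq0 => E0.
  have := specht_gram; rewrite mulmxA E0 mul0mx => /esym/eqP.
  by rewrite scaler_eq0 (negPf eigenval_neq0).
have eE : U *m Phi n k C *m wreath_mx n k C = eigenval *: (U *m Phi n k C).
  by rewrite wreath_mx_Phi // mulmxA -(mulmxA U) specht_gram scalemxAl.
split=> [/eigenspaceP|->]; last exact/eigenspaceP.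
rewrite eE => /eqP; rewrite -subr_eq0 -scalerBl scaler_eq0 (negPf E0) orbF.
by rewrite subr_eq0 => /eqP.
Qed.

End Eigenvalue.

Theorem proposition4p3 (R : realType) (n k l j : nat)
    (n_gt0 : (0 < n)%N) (k_gt0 : (0 < k)%N) (ltkn : (2 * k < n)%N)
    (le2lk : (2 <= l <= k)%N) (lejl : (j <= l)%N) (dvdkn : (k %| n)%N) :
  b_coef n k R[i] l j =
    (if (j == 0)%N then
       ((n - 2 * k)`!)%:R
         / ((k`!)%:R ^+ (n %/ k - 2) * ((n %/ k - 2)`!)%:R)
         * 'C(n - k - l, k - l)%:R
     else if (j < l)%N then 0
     else ((n - k)`!)%:R / ((k`!)%:R ^+ (n %/ k - 1) * ((n %/ k - 1)`!)%:R))
  /\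
  forall U : nat -> 'M[R[i]]_#|ksubsets n k|,
    Vk_decomposition U ->
    is_lambda U l
      (((n - k)`!)%:R / ((k`!)%:R ^+ (n %/ k - 1) * ((n %/ k - 1)`!)%:R)
       + (-1) ^+ l
         * (((n - 2 * k)`!)%:R
              / ((k`!)%:R ^+ (n %/ k - 2) * ((n %/ k - 2)`!)%:R)
            * 'C(n - k - l, k - l)%:R)).
Proof.
case/andP: le2lk => le2l lelk; have n_gt1 : (1 < n)%N by lia.
have emk : (n %/ k * k = n)%N := mk_n dvdkn.
have N1 : (npart k (n %/ k - 1))%:R = ((n - k)`!)%:R
    / ((k`!)%:R ^+ (n %/ k - 1) * ((n %/ k - 1)`!)%:R) :> R[i].
  by rewrite npartE // mulnBl mul1n emk.
have N2 : (npart k (n %/ k - 2))%:R = ((n - 2 * k)`!)%:R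
    / ((k`!)%:R ^+ (n %/ k - 2) * ((n %/ k - 2)`!)%:R) :> R[i].
  by rewrite npartE // mulnBl emk.
split.
  rewrite b_coefE //; last by rewrite (ltnW le2l).
  by rewrite -N1 -N2 -natrM; case: ifP => // _; case: ifP.
move=> U [simU _ _]; have [modU rsimU] := simU l lelk.
rewrite -N1 -N2 -natrM => a.
exact: (specht_image_eigenspace n_gt1 k_gt0 dvdkn ltkn le2l lelk rsimU).
Qed.
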